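(* Suppose $E:\mathcal{P}_{2,\omega_0}(\mathbb{R}^d)\to\mathbb{R}\cup\{+\infty\}$ is proper, coercive, lower semicontinuous and $\lambda$-convex along generalized geodesics for some $\lambda\in\mathbb{R}$, and let $\mu\in D(|\partial E|)$, $\nu\in\overline{D(E)}$. Then for all $0<\tau<\frac1{\lambda^-}$: if $\lambda>0$, $(1+\lambda\tau)^2W_2^2(J_\tau\mu,J_\tau\nu)\le W_2^2(\mu,\nu)+\tau^2|\partial E|^2(\mu)+2\lambda\tau^2[E(\nu)-\inf E]$; if $\lambda\le0$, $(1+\lambda\tau)^2W_2^2(J_\tau\mu,J_\tau\nu)\le W_2^2(\mu,\nu)+\tau^2|\partial E|^2(\mu)$.
   Context: Fix a probability measure $\omega_0$ on $\mathbb{R}^d$. $W_2$ is the quadratic Wasserstein distance, $\Gamma_0(\mu,\nu)$ the optimal couplings; $\mathcal{P}_{2,\omega_0}(\mathbb{R}^d)=\{\mu:W_2(\mu,\omega_0)<\infty\}$. A transport plan from $\mu_0$ to $\mu_1$ with base $\omega$ is $\boldsymbol\omega\in\mathcal{P}((\mathbb{R}^d)^3)$ with $\pi^{1,2}\#\boldsymbol\omega\in\Gamma_0(\omega,\mu_0)$, $\pi^{1,3}\#\boldsymbol\omega\in\Gamma_0(\omega,\mu_1)$; generalized geodesic $\mu_\alpha=((1-\alpha)\pi^2+\alpha\pi^3)\#\boldsymbol\omega$; $W_{2,\boldsymbol\omega}(\mu_0,\mu_1)=(\int|x_2-x_3|^2d\boldsymbol\omega)^{1/2}$. $D(E)=\{E<\infty\}$;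 proper: $D(E)\ne\emptyset$; coercive: $\exists\tau_0>0,u_0$ with $\inf_v\{\frac1{2\tau_0}W_2^2(u_0,v)+E(v)\}>-\infty$; lower semicontinuous w.r.t. $W_2$; $\lambda$-convex along generalized geodesics: for all $\mu_0,\mu_1,\omega$ there is a generalized geodesic from $\mu_0$ to $\mu_1$ with base $\omega$ (induced by some $\boldsymbol\omega$) with $E(\mu_\alpha)\le(1-\alpha)E(\mu_0)+\alpha E(\mu_1)-\alpha(1-\alpha)\frac\lambda2W^2_{2,\boldsymbol\omega}(\mu_0,\mu_1)$. $\lambda^-=\max\{0,-\lambda\}$, $1/\lambda^-=+\infty$ if $\lambda^-=0$; $\overline{D(E)}$ is the $W_2$-closure. $J_\tau\mu=\operatorname{argmin}_\nu\{\frac1{2\tau}W_2^2(\mu,\nu)+E(\nu)\}$ (well defined for $\mu\in\overline{D(E)}$, $0<\tau<1/\lambda^-$). Metric slope $|\partial E|(\mu)=\limsup_{\nu\to\mu}(E(\mu)-E(\nu))^+/W_2(\mu,\nu)$; $D(|\partial E|)=\{\mu\in D(E):|\partial E|(\mu)<\infty\}$. *)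

(* Defs.v *)
From HB Require Import structures.
From mathcomp Require Import all_boot all_order all_algebra.
From mathcomp Require Import all_classical all_reals all_analysis.
Set Implicit Arguments. Unset Strict Implicit. Unset Printing Implicit Defensive.
Import Order.TTheory GRing.Theory Num.Theory.
Import numFieldNormedType.Exports.
Local Open Scope classical_set_scope.
Local Open Scope ring_scope.

Section Wasserstein.
Variables (R : realType) (d : nat).

(* R^d as row vectors, equipped with its Borel sigma-algebra
   (generated by the open sets of the product topology = Euclidean topology). *)
Definition Rd : Type := g_sigma_algebraType (@open ('rV[R]_d)).
HB.instance Definition _ := Measurable.on Rd.

Definition sqd (x y : 'rV[R]_d) : R := \sum_(i < d) (x ord0 i - y ord0 i) ^+ 2.

Local Open Scope ereal_scope.

Definition is_coupling {dU} {U : measurableType dU} (P : probability U R)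
  (f g : U -> Rd) (mu nu : probability Rd R) : Prop :=
  [/\ measurable_fun setT f, measurable_fun setT g,
      (forall A : set Rd, measurable A -> P (f @^-1` A) = mu A) &
      (forall A : set Rd, measurable A -> P (g @^-1` A) = nu A)].

Definition cost {dU} {U : measurableType dU} (P : probability U R)
  (f g : U -> Rd) : \bar R :=
  \int[P]_u (sqd (f u) (g u))%:E.

Definition W2sq (mu nu : probability Rd R) : \bar R :=
  ereal_inf [set cost P fst snd | P in
     [set P : probability (Rd * Rd)%type R | is_coupling P fst snd mu nu]].

Definition W2 (mu nu : probability Rd R) : \bar R := sqrte (W2sq mu nu).

Definition optimal_via {dU} {U : measurableType dU} (P : probability U R)
  (f g : U -> Rd) (mu nu : probability Rd R) : Prop :=
  is_coupling P f g mu nu /\ cost P f g = W2sq mu nu.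

Definition P2 (omega0 : probability Rd R) : set (probability Rd R) :=
  [set mu | W2 mu omega0 < +oo].

Variables (omega0 : probability Rd R) (E : probability Rd R -> \bar R).

Definition no_minus_infty : Prop := forall mu, P2 omega0 mu -> E mu != -oo.

Definition domE : set (probability Rd R) :=
  [set mu | P2 omega0 mu /\ E mu < +oo].

Definition E_proper : Prop := exists mu, domE mu.

Definition E_coercive : Prop :=
  exists tau0 : R, (0 < tau0)%R /\ exists u0, P2 omega0 u0 /\
    -oo < ereal_inf [set ((2 * tau0)^-1)%:E * W2sq u0 v + E v | v in P2 omega0].

Definition W2_lsc : Prop :=
  forall mu, P2 omega0 mu -> forall c : R, c%:E < E mu ->
    exists delta : R, (0 < delta)%R /\
      forall nu, P2 omega0 nu -> W2 mu nu < delta%:E -> c%:E < E nu.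

Definition gg_convex (lam : R) : Prop :=
  forall mu0 mu1 w, P2 omega0 mu0 -> P2 omega0 mu1 -> P2 omega0 w ->
  exists W : probability (Rd * Rd * Rd)%type R,
    [/\ optimal_via W (fun x => x.1.1) (fun x => x.1.2) w mu0,
        optimal_via W (fun x => x.1.1) (fun x => x.2) w mu1 &
        forall alpha : R, (0 <= alpha <= 1)%R ->
        forall mua : probability Rd R,
          (forall A : set Rd, measurable A ->
             mua A = W ((fun x : Rd * Rd * Rd =>
                 ((1 - alpha) *: (x.1.2 : 'rV[R]_d) + alpha *: (x.2 : 'rV[R]_d))%R
                   : Rd) @^-1` A)) ->
          E mua <= ((1 - alpha)%R)%:E * E mu0 + alpha%:E * E mu1
                   - (alpha * (1 - alpha) * lam / 2)%:E
                     * cost W (fun x => x.1.2) (fun x => x.2)].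

Definition closure_domE : set (probability Rd R) :=
  [set nu | P2 omega0 nu /\ forall eps : R, (0 < eps)%R ->
      exists nu', domE nu' /\ W2 nu nu' < eps%:E].

(* metric slope: limsup_{nu -> mu} (E mu - E nu)^+ / W2(mu, nu),
   i.e. inf_{r > 0} sup_{0 < W2(mu,nu) < r} ... (with the value 0 for
   an isolated point) *)
Definition metric_slope (mu : probability Rd R) : \bar R :=
  ereal_inf [set ereal_sup ([set 0] `|`
     [set maxe (E mu - E nu) 0 * ((fine (W2 mu nu))^-1)%:E
        | nu in [set nu | P2 omega0 nu /\ 0 < W2 mu nu < r%:E]])
   | r in [set r : R | (0 < r)%R]].

Definition dom_slope : set (probability Rd R) :=
  [set mu | domE mu /\ metric_slope mu < +oo].

Definition is_JKO (tau : R) (mu m : probability Rd R) : Prop :=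
  P2 omega0 m /\ forall v, P2 omega0 v ->
    ((2 * tau)^-1)%:E * W2sq mu m + E m <= ((2 * tau)^-1)%:E * W2sq mu v + E v.

Definition infE : \bar R := ereal_inf [set E v | v in P2 omega0].

End Wasserstein.

(* 1 / lambda^- in \bar R, with 1/0 = +oo *)
Definition inv_lambda_minus (R : realType) (lam : R) : \bar R :=
  if (0 <= lam)%R then +oo%E else ((- lam)^-1)%:E.

(* Main.v *)
(** Write W for the Wasserstein distance, S for the slope at mu, k = 1 + lam tau.
    Comparing a minimizer Jmu with the generalized geodesic of base mu joining it
    to v gives the discrete variational inequality
      k W(Jmu, v)^2 <= W(mu, v)^2 - W(mu, Jmu)^2 + 2 tau (E v - E Jmu).
    It is used for (mu, v = Jnu) and for (nu, v = mu), together with the bound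
    E mu - E v <= S W(mu, v) - (lam / 2) W(mu, v)^2.  For lam > 0, k times
    the first inequality plus the second one suffices.  For lam <= 0 the energy
    difference between mu and Jnu is eliminated with the second inequality, and
    what is left is absorbed by
      k (1 - k) W(mu, Jnu)^2 <= (1 - k) W(mu, nu)^2 + k W(nu, Jnu)^2.
    None of this uses the triangle inequality for W: only the finiteness of W is
    transitive, which keeps generalized geodesics at finite distance from omega0. *)
Require Import Defs.
From HB Require Import structures.
From mathcomp Require Import all_boot all_order all_algebra.
From mathcomp Require Import all_classical all_reals all_analysis.
From mathcomp Require Import measurable_realfun ring lra.
Set Implicit Arguments.
Unset Strict Implicit.
Unset Printing Implicit Defensive.
Import Order.TTheory GRing.Theory Num.Theory.
Import numFieldNormedType.Exports.
Local Open Scope classical_set_scope.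
Local Open Scope ring_scope.

Lemma open_bigcup_ball {R : realType} {T : pseudoMetricType R} {I : Type}
    (c : I -> T) (O : set T) :
  (forall (x : T) (e : R), 0 < e -> exists i, ball (c i) e x) -> open O ->
  O = \bigcup_(p in [set p : I * nat | ball (c p.1) p.2.+1%:R^-1 `<=` O])
        ball (c p.1) p.2.+1%:R^-1.
Proof.
move=> c_dense oO; apply/seteqP; split=> [x Ox|x [p]]; last exact.
have /nbhs_ballP[e /= e0 xeO] := open_nbhs_nbhs (conj oO Ox).
have e2 : 0 < e / 2 by rewrite divr_gt0.
have [n _ /(_ n (leqnn n)) ne] := near_infty_natSinv_lt (PosNum e2).
have [i ix] : exists i, ball (c i) n.+1%:R^-1 x.
  by apply: c_dense; rewrite invr_gt0.
exists (i, n) => // y iy; apply/xeO/(@ball_splitr _ _ (c i)).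
  exact: le_ball (ltW ne) _ ix.
exact: le_ball (ltW ne) _ iy.
Qed.

Section measure_theory.
Local Open Scope ereal_scope.

Lemma measurable_preimageT {d1 d2} {T1 : measurableType d1}
    {T2 : measurableType d2} (f : T1 -> T2) (A : set T2) :
  measurable_fun setT f -> measurable A -> measurable (f @^-1` A).
Proof. by move=> mf mA; rewrite -[X in measurable X]setTI; exact: mf. Qed.

Lemma trivIset_preimage {T1 T2 I : Type} (D : set I) (F : I -> set T2)
    (f : T1 -> T2) : trivIset D F -> trivIset D (fun i => f @^-1` F i).
Proof. by move=> tF i j Di Dj [x [Fi Fj]]; apply: tF => //; exists (f x). Qed.

Lemma measure_partition {d} {T : measurableType d} {R : realType}
    (mu : {measure set T -> \bar R}) (B : (set T)^nat) (A : set T) :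
  (forall n, measurable (B n)) -> trivIset setT B -> \bigcup_n B n = setT ->
  measurable A -> \sum_(n <oo) mu (A `&` B n) = mu A.
Proof.
move=> mB tB cB mA.
have mAB n : measurable (A `&` B n) by exact: measurableI.
rewrite -measure_semi_bigcup//; first by rewrite -setI_bigcupr cB setIT.
- exact: trivIset_setIl.
- exact: bigcup_measurable.
Qed.

Section law.
Context {dU dV : measure_display} {U : measurableType dU} {V : measurableType dV}
  {R : realType} (P : probability U R) (X : U -> V).
Hypothesis mX : measurable_fun setT X.

Lemma exists_law : exists N : probability V R, forall A, N A = P (X @^-1` A).
Proof.
pose X' : {mfun U >-> V} := HB.pack X (isMeasurableFun.Build _ _ _ _ X mX).
by exists (distribution P X').
Qed.

Lemma ge0_integral_law (N : probability V R) (g : V -> \bar R) :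
  (forall A, measurable A -> N A = P (X @^-1` A)) ->
  measurable_fun setT g -> (forall v, 0 <= g v) ->
  \int[N]_v g v = \int[P]_u g (X u).
Proof.
move=> NE mg g0; rewrite -[RHS](ge0_integral_pushforward mX P measurableT)//.
by apply: eq_measure_integral => A mA _; exact: NE.
Qed.

End law.

Lemma mulVeK_le {R : realFieldType} (x p : \bar R) : 0 <= x -> x <= p ->
  p \is a fin_num -> ((fine p)^-1)%:E * (x * p) = x.
Proof.
move=> x0 xp pfin; have [p0|p0] := eqVneq p 0.
  by rewrite p0 mule0 mule0; apply/esym/le_anti; rewrite x0 -p0 xp.
by rewrite muleCA -{2}(fineK pfin) -EFinM mulVf ?mule1// fine_eq0.
Qed.

Section coupling_along_partitions.
Context {dU dV : measure_display} {U : measurableType dU} {V : measurableType dV}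
  {R : realType} (P : probability U R) (Q : probability V R).
Variables (B : (set U)^nat) (C : (set V)^nat).
Hypotheses (mB : forall n, measurable (B n)) (mC : forall n, measurable (C n)).
Hypotheses (tB : trivIset setT B) (tC : trivIset setT C).
Hypotheses (cB : \bigcup_n B n = setT) (cC : \bigcup_n C n = setT).
Hypothesis PQ : forall n, P (B n) = Q (C n).

Let weight_ge0 n : (0 <= (fine (P (B n)))^-1)%R.
Proof. by rewrite invr_ge0 fine_ge0. Qed.

(* On a null cell the weight is [0^-1 = 0], so that the coupling vanishes. *)
Definition cell_coupling n : {measure set (U * V) -> \bar R} :=
  mscale (NngNum (weight_ge0 n)) (mrestr P (mB n) \x mrestr Q (mC n)).

Lemma cell_coupling_fst n A : measurable A ->
  cell_coupling n (fst @^-1` A) = P (A `&` B n).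
Proof.
move=> mA; rewrite /cell_coupling /= /mscale/= -setXT product_measure1E//.
rewrite /= /mrestr setTI -PQ mulVeK_le//.
  by apply: measureIr.
exact: fin_num_measure.
Qed.

Lemma cell_coupling_snd n A : measurable A ->
  cell_coupling n (snd @^-1` A) = Q (A `&` C n).
Proof.
move=> mA; rewrite /cell_coupling /= /mscale/= -setTX product_measure1E//.
rewrite /= /mrestr setTI PQ [X in _ * X]muleC mulVeK_le//.
  by apply: measureIr.
exact: fin_num_measure.
Qed.

Lemma cell_coupling_off_cell n : cell_coupling n (~` (B n `*` C n)) = 0.
Proof.
have -> : ~` (B n `*` C n) = fst @^-1` (~` B n) `|` snd @^-1` (~` C n).
  by rewrite -setCI.
apply/eqP; rewrite eq_le measure_ge0 andbT.
have [mCB mCC] := (measurableC (mB n), measurableC (mC n)).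
have mfst := measurable_preimageT (@measurable_fst _ _ U V) mCB.
have msnd := measurable_preimageT (@measurable_snd _ _ U V) mCC.
apply: le_trans (measureU2 _ mfst msnd) _.
rewrite [X in X + _]cell_coupling_fst ?[X in _ + X]cell_coupling_snd//.
by rewrite !setICl !measure0 adde0.
Qed.

Lemma exists_coupling_along_partitions : exists M : probability (U * V)%type R,
  [/\ forall A, measurable A -> M (fst @^-1` A) = P A,
      forall A, measurable A -> M (snd @^-1` A) = Q A &
      {ae M, forall z, exists n, B n z.1 /\ C n z.2}].
Proof.
pose M : {measure set (U * V) -> \bar R} := mseries cell_coupling 0.
have Mfst A : measurable A -> M (fst @^-1` A) = P A.
  move=> mA; rewrite -(measure_partition P mB)// /M/= /mseries.
  by apply: eq_eseriesr => n _; exact: cell_coupling_fst.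
have Msnd A : measurable A -> M (snd @^-1` A) = Q A.
  move=> mA; rewrite -(measure_partition Q mC)// /M/= /mseries.
  by apply: eq_eseriesr => n _; exact: cell_coupling_snd.
have M1 : M setT = 1 by rewrite -(preimage_setT fst) Mfst// probability_setT.
pose M' : probability (U * V)%type R :=
  HB.pack (mseries cell_coupling 0) (Measure_isProbability.Build _ _ _ M M1).
exists M'; split => //=.
have mBC n : measurable (B n `*` C n) by exact: measurableX.
exists (~` \bigcup_n (B n `*` C n)); split.
- by apply: measurableC; exact: bigcup_measurable.
- rewrite /= /mseries eseries0// => n _ _.
  apply: (subset_measure0 _ _ _ (cell_coupling_off_cell n)).
  + by apply: measurableC; exact: bigcup_measurable.
  + exact: measurableC.
  + by apply: subsetC => z Bz; exists n.
- by apply: subsetC => z [n _ [Bz Cz]]; exists n.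
Qed.

End coupling_along_partitions.
End measure_theory.

Section Euclidean_space.
Context {R : realType} {d : nat}.
Local Notation Rd := (Rd R d).
Implicit Types x y z : 'rV[R]_d.

Lemma ratr_row_dense x (e : R) : 0 < e ->
  exists q : 'rV[rat]_d, ball (map_mx ratr q : 'rV[R]_d) e x.
Proof.
move=> e0.
have /choice[q xq] i : exists q : rat, `|ratr q - x ord0 i| < e.
  have [|q] := @rat_in_itvoo R (x ord0 i - e) (x ord0 i + e); first by lra.
  by rewrite in_itv /= => xq; exists q; rewrite ltr_distlC addrC; lra.
exists (\row_i q i); split=> // i j; rewrite ord1 !mxE -ball_normE /=.
exact: xq.
Qed.

Lemma measurable_coord (i : 'I_d) :
  measurable_fun setT (fun x : Rd => (x : 'rV[R]_d) ord0 i).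
Proof.
apply: (measurability _ (RGenOpens.measurableE R)).
move=> _ [_ [a [b ->]] <-]; rewrite setTI; apply: sub_sigma_algebra.
apply: (open_comp (f := fun x : 'rV[R]_d => x ord0 i)) => [x _|].
  exact: coord_continuous.
exact: interval_open.
Qed.

Section measurable_functions.
Context {dU : measure_display} {U : measurableType dU}.
Implicit Types f g : U -> Rd.

Lemma measurable_fun_coord f i : measurable_fun setT f ->
  measurable_fun setT (fun u => (f u : 'rV[R]_d) ord0 i).
Proof. by move=> mf; apply: (measurableT_comp (measurable_coord i)). Qed.

Lemma measurable_fun_Rd f :
  (forall i, measurable_fun setT (fun u => (f u : 'rV[R]_d) ord0 i)) ->
  measurable_fun setT f.
Proof.
move=> mf; apply: (@measurability _ _ U Rd setT f (@open 'rV[R]_d)) => //.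
move=> _ [V oV <-]; rewrite setTI (open_bigcup_ball ratr_row_dense oV).
rewrite preimage_bigcup bigcup_mkcond.
apply: countable_bigcupT_measurable; first exact: countableP.
move=> p; case: ifP => // _.
set c := map_mx _ _; set r := _^-1.
have -> : f @^-1` ball c r = \bigcap_(i in [set: 'I_d])
    ((fun u => (f u : 'rV[R]_d) ord0 i) @^-1` ball (c ord0 i) r).
  apply/seteqP; split=> [u [_ cu] i _|u cu]; first exact: cu.
  by split=> [|i j]; [rewrite invr_gt0|rewrite ord1; exact: cu].
apply: fin_bigcap_measurable => [|i _]; first exact: finite_finset.
by apply: measurable_preimageT => //; apply: open_measurable; exact: ball_open.
Qed.

Lemma measurable_sqd f g : measurable_fun setT f -> measurable_fun setT g ->
  measurable_fun setT (fun u => sqd (f u) (g u)).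
Proof.
move=> mf mg; apply: measurable_sum => i; apply: measurable_funX.
by apply: measurable_funB; exact: measurable_fun_coord.
Qed.

Lemma measurable_lincomb f g (a b : R) :
  measurable_fun setT f -> measurable_fun setT g ->
  measurable_fun setT
    (fun u => a *: (f u : 'rV[R]_d) + b *: (g u : 'rV[R]_d) : Rd).
Proof.
move=> mf mg; apply: measurable_fun_Rd => i.
under eq_fun do rewrite !mxE.
by apply: measurable_funD; apply: measurable_funM => //;
  exact: measurable_fun_coord.
Qed.

End measurable_functions.

Lemma sqd_ge0 x y : 0 <= sqd x y.
Proof. by apply: sumr_ge0 => i _; exact: sqr_ge0. Qed.

Lemma sqdC x y : sqd x y = sqd y x.
Proof. by apply: eq_bigr => i _; rewrite -sqrrN opprB. Qed.

Lemma sqdxx x : sqd x x = 0.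
Proof. by apply: big1 => i _; rewrite subrr expr0n. Qed.

Lemma sqd_interpolation x y z (a : R) :
  sqd x ((1 - a) *: y + a *: z) + a * (1 - a) * sqd y z =
  (1 - a) * sqd x y + a * sqd x z.
Proof.
rewrite /sqd !mulr_sumr -!big_split /=; apply: eq_bigr => i _.
by rewrite !mxE; ring.
Qed.

Lemma sqd_quasi_triangle x y z : sqd x z <= 2 * sqd x y + 2 * sqd y z.
Proof.
rewrite /sqd !mulr_sumr -!big_split /=; apply: ler_sum => i _.
rewrite -subr_ge0.
rewrite (_ : _ - _ = (x ord0 i - y ord0 i - (y ord0 i - z ord0 i)) ^+ 2).
  exact: sqr_ge0.
by ring.
Qed.

Lemma sqd_ball x y : ball x 1 y -> sqd x y <= d%:R.
Proof.
move=> [_ xy].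
rewrite -[leRHS]mulr1 mulr_natl -[X in _ *+ X]card_ord -sumr_const.
apply: ler_sum => i _; rewrite -real_normK ?num_real// exprn_ile1//.
by have := xy ord0 i; rewrite -ball_normE => /ltW.
Qed.

Lemma measurable_ball_Rd x (e : R) : measurable (ball x e : set Rd).
Proof. by apply: sub_sigma_algebra; exact: ball_open. Qed.

Lemma exists_bounded_partition : exists D : (set Rd)^nat,
  [/\ forall n, measurable (D n), trivIset setT D, \bigcup_n D n = setT &
      forall n x y, D n x -> D n y -> sqd x y <= d%:R].
Proof.
pose c n : 'rV[R]_d := map_mx ratr (odflt 0 (unpickle n : option 'rV[rat]_d)).
exists (seqDU (fun n => ball (c n) (1 / 2))); split.
- by apply: seqDU_measurable => n; exact: measurable_ball_Rd.
- exact: trivIset_seqDU.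
- rewrite -seqDU_bigcup_eq -subTset => x _.
  have [q xq] : exists q : 'rV[rat]_d, ball (map_mx ratr q : 'rV[R]_d) (1 / 2) x.
    by apply: ratr_row_dense; rewrite divr_gt0.
  by exists (pickle q) => //; rewrite /c pickleK.
- move=> n x y Dx Dy; apply: sqd_ball.
  exact: ball_splitr (subset_seqDU Dx) (subset_seqDU Dy).
Qed.

End Euclidean_space.

Section transport_cost.
Context {R : realType} {d : nat}.
Local Notation Rd := (Rd R d).
Local Open Scope ereal_scope.

Section cost.
Context {dU : measure_display} {U : measurableType dU} (P : probability U R).
Implicit Types f g h k : U -> Rd.

Lemma cost_ge0 f g : 0 <= cost P f g.
Proof. by apply: integral_ge0 => u _; rewrite lee_fin sqd_ge0. Qed.

Lemma costC f g : cost P f g = cost P g f.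
Proof. by apply: eq_integral => u _; rewrite sqdC. Qed.

Lemma measurable_EFin_sqd f g :
  measurable_fun setT f -> measurable_fun setT g ->
  measurable_fun setT (fun u => (sqd (f u) (g u))%:E).
Proof. by move=> mf mg; apply/measurable_EFinP/measurable_sqd. Qed.

Lemma integral_sqd_lincomb f g h k (a b : R) : (0 <= a)%R -> (0 <= b)%R ->
  measurable_fun setT f -> measurable_fun setT g ->
  measurable_fun setT h -> measurable_fun setT k ->
  \int[P]_u (a * sqd (f u) (g u) + b * sqd (h u) (k u))%:E =
  a%:E * cost P f g + b%:E * cost P h k.
Proof.
move=> a0 b0 mf mg mh mk.
have ge0 (c : R) f' g' u : (0 <= c)%R -> 0 <= c%:E * (sqd (f' u) (g' u : Rd))%:E.
  by move=> c0; rewrite -EFinM lee_fin mulr_ge0// sqd_ge0.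
have sqd0 f' g' u : 0 <= (sqd (f' u : Rd) (g' u))%:E by rewrite lee_fin sqd_ge0.
have [mfg mhk] := (measurable_EFin_sqd mf mg, measurable_EFin_sqd mh mk).
under eq_integral do rewrite EFinD !EFinM.
rewrite ge0_integralD//; [|by move=> u _; exact: ge0|exact: measurable_funeM
  |by move=> u _; exact: ge0|exact: measurable_funeM].
by rewrite !ge0_integralZl_EFin// => u _; exact: sqd0.
Qed.

Lemma cost_interpolation f g h (a : R) : (0 <= a <= 1)%R ->
  measurable_fun setT f -> measurable_fun setT g -> measurable_fun setT h ->
  cost P f (fun u => (1 - a) *: (g u : 'rV[R]_d) + a *: (h u : 'rV[R]_d))%R
    + (a * (1 - a))%:E * cost P g h
  = (1 - a)%:E * cost P f g + a%:E * cost P f h.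
Proof.
move=> /andP[a0 a1] mf mg mh; have a1' : (0 <= 1 - a)%R by rewrite subr_ge0.
rewrite -integral_sqd_lincomb// -[X in X + _]mul1e -integral_sqd_lincomb//.
- by apply: eq_integral => u _; rewrite mul1r sqd_interpolation.
- exact: mulr_ge0.
- exact: measurable_lincomb.
Qed.

Lemma cost_quasi_triangle f g h :
  measurable_fun setT f -> measurable_fun setT g -> measurable_fun setT h ->
  cost P f h <= 2%:E * cost P f g + 2%:E * cost P g h.
Proof.
move=> mf mg mh; rewrite -integral_sqd_lincomb//; apply: ge0_le_integral => //.
- by move=> u _; rewrite lee_fin sqd_ge0.
- exact: measurable_EFin_sqd.
- apply/measurable_EFinP; apply: measurable_funD;
    by apply: measurable_funM => //; exact: measurable_sqd.
- by move=> u _; rewrite lee_fin sqd_quasi_triangle.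
Qed.

Lemma cost_lty_trans f g h :
  measurable_fun setT f -> measurable_fun setT g -> measurable_fun setT h ->
  cost P f g < +oo -> cost P g h < +oo -> cost P f h < +oo.
Proof.
move=> mf mg mh fg gh; apply: le_lt_trans (cost_quasi_triangle mf mg mh) _.
by rewrite lte_add_pinfty// lte_mul_pinfty.
Qed.

Lemma ae_bounded_cost_lty f g (c : R) :
  measurable_fun setT f -> measurable_fun setT g ->
  {ae P, forall u, (sqd (f u) (g u) <= c)%R} -> cost P f g < +oo.
Proof.
move=> mf mg fgc.
apply: (@le_lt_trans _ _ (\int[P]_u (Num.max 0 c)%:E)); last first.
  by rewrite integral_cst// [X in _ * X]probability_setT mule1 ltry.
apply: ae_ge0_le_integral => //.
- by move=> u _; rewrite lee_fin sqd_ge0.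
- exact: measurable_EFin_sqd.
- by move=> u _; rewrite lee_fin le_max lexx.
- by apply: filterS fgc => u fgu _; rewrite lee_fin le_max fgu orbT.
Qed.

End cost.

Lemma cost_law {dU dV} {U : measurableType dU} {V : measurableType dV}
    (P : probability U R) (X : U -> V) (N : probability V R) (f g : V -> Rd) :
  measurable_fun setT X -> (forall A, measurable A -> N A = P (X @^-1` A)) ->
  measurable_fun setT f -> measurable_fun setT g ->
  cost N f g = cost P (f \o X) (g \o X).
Proof.
move=> mX NE mf mg; rewrite /cost (ge0_integral_law mX NE)//.
  exact: measurable_EFin_sqd.
by move=> v; rewrite lee_fin sqd_ge0.
Qed.

Implicit Types mu nu rho sigma eta : probability Rd R.

Lemma W2sq_le_cost {dU} {U : measurableType dU} (P : probability U R)
    (f g : U -> Rd) mu nu :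
  is_coupling P f g mu nu -> W2sq mu nu <= cost P f g.
Proof.
move=> [mf mg Pf Pg].
have mfg : measurable_fun setT (fun u => (f u, g u)) by exact: measurable_fun_pair.
have [N NE] := exists_law P mfg.
apply: ereal_inf_lbound; exists N; first split => // A mA.
- by rewrite NE -Pf.
- by rewrite NE -Pg.
- exact: (cost_law mfg (fun A _ => NE A)).
Qed.

Lemma W2sq_ge0 mu nu : 0 <= W2sq mu nu.
Proof. by apply: le_ereal_inf_tmp => _ [P _ <-]; exact: cost_ge0. Qed.

Lemma W2sqC mu nu : W2sq mu nu = W2sq nu mu.
Proof.
suff W2sqC_le mu' nu' : W2sq mu' nu' <= W2sq nu' mu'.
  by apply/eqP; rewrite eq_le !W2sqC_le.
apply: le_ereal_inf_tmp => _ [P [m1 m2 P1 P2] <-].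
by rewrite costC; apply: W2sq_le_cost.
Qed.

Lemma W2sqxx mu : W2sq mu mu = 0.
Proof.
apply/eqP; rewrite eq_le W2sq_ge0 andbT.
apply: (le_trans (@W2sq_le_cost _ _ mu id id mu mu _)) => //.
by rewrite /cost integral0_eq// => u _; rewrite sqdxx.
Qed.

Lemma W2sq_interpolation {dU} {U : measurableType dU} (P : probability U R)
    (f g h : U -> Rd) rho mu nu eta (a : R) :
  is_coupling P f g rho mu -> is_coupling P f h rho nu -> (0 <= a <= 1)%R ->
  (forall A, measurable A -> eta A = P ((fun u =>
     (1 - a) *: (g u : 'rV[R]_d) + a *: (h u : 'rV[R]_d) : Rd)%R @^-1` A)) ->
  W2sq rho eta + (a * (1 - a))%:E * cost P g h <=
  (1 - a)%:E * cost P f g + a%:E * cost P f h.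
Proof.
move=> [mf mg Pf _] [_ mh _ _] a01 etaE.
rewrite -cost_interpolation// leeD2r//; apply: W2sq_le_cost.
split=> // [|A mA]; first exact: measurable_lincomb.
by rewrite etaE.
Qed.

(* The two plans are glued only approximately, their middle coordinates being
   required to lie in the same cell of a countable partition into sets of bounded
   diameter: this avoids disintegration and costs only an additive constant. *)
Lemma W2sq_lty_glue {dU dV} {U : measurableType dU} {V : measurableType dV}
    (P : probability U R) (Q : probability V R) (f g : U -> Rd) (h k : V -> Rd)
    rho sigma eta :
  is_coupling P f g rho sigma -> is_coupling Q h k sigma eta ->
  cost P f g < +oo -> cost Q h k < +oo -> W2sq rho eta < +oo.
Proof.
move=> [mf mg Pf Pg] [mh mk Qh Qk] Pfg Qhk.
have [D [mD tD cD D_bounded]] := @exists_bounded_partition R d.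
have cell_cover T (F : T -> Rd) : \bigcup_n (F @^-1` D n) = setT.
  by rewrite -preimage_bigcup cD preimage_setT.
have PQ_cell n : P (g @^-1` D n) = Q (h @^-1` D n) by rewrite Pg// Qh.
have [M [M1 M2 M_cell]] := exists_coupling_along_partitions
  (fun n => measurable_preimageT mg (mD n))
  (fun n => measurable_preimageT mh (mD n))
  (trivIset_preimage tD) (trivIset_preimage tD)
  (cell_cover _ g) (cell_cover _ h) PQ_cell.
have mfst (F : U -> Rd) : measurable_fun setT F ->
    measurable_fun setT (F \o @fst U V).
  by move=> mF; exact: measurableT_comp.
have msnd (F : V -> Rd) : measurable_fun setT F ->
    measurable_fun setT (F \o @snd U V).
  by move=> mF; exact: measurableT_comp.
apply: (le_lt_trans (@W2sq_le_cost _ _ M (f \o fst) (k \o snd) rho eta _)).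
  split=> [||A mA|A mA]; [exact: mfst|exact: msnd| |].
  - by rewrite -Pf// -M1//; exact: measurable_preimageT.
  - by rewrite -Qk// -M2//; exact: measurable_preimageT.
apply: (cost_lty_trans (mfst _ mf) (mfst _ mg) (msnd _ mk)).
  by rewrite -(cost_law measurable_fst (fun A mA => esym (M1 A mA))).
apply: (cost_lty_trans (mfst _ mg) (msnd _ mh) (msnd _ mk)); last first.
  by rewrite -(cost_law measurable_snd (fun A mA => esym (M2 A mA))).
apply: (ae_bounded_cost_lty (mfst _ mg) (msnd _ mh) (c := d%:R)).
by apply: filterS M_cell => z [n [gz hz]]; exact: D_bounded gz hz.
Qed.

Lemma W2sq_lty_trans rho sigma eta :
  W2sq rho sigma < +oo -> W2sq sigma eta < +oo -> W2sq rho eta < +oo.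
Proof.
move=> /ereal_inf_lt[_ [P cP <-] Poo] /ereal_inf_lt[_ [Q cQ <-] Qoo].
exact: W2sq_lty_glue cP cQ Poo Qoo.
Qed.

End transport_cost.

Lemma ler_affine_limit {R : realFieldType} (x y z b : R) : 0 < b ->
  (forall a : R, 0 < a < b -> x - a * y <= z) -> x <= z.
Proof.
move=> b0 xyz; apply/ler_addgt0Pr => e e0.
have y0 : 0 < `|y| + 1 by rewrite ltr_wpDl.
pose a := Num.min (b / 2) (e / (`|y| + 1)).
have a0 : 0 < a by rewrite lt_min !divr_gt0.
have ab : a <= b / 2 by rewrite ge_min lexx.
have aye : a * y <= e.
  have : a * (`|y| + 1) <= e by rewrite -ler_pdivlMr// ge_min lexx orbT.
  by apply: le_trans; rewrite ler_pM2l// (le_trans (ler_norm y))// lerDl.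
have : x - a * y <= z by apply: xyz; rewrite a0/=; lra.
lra.
Qed.

Section generalized_convexity.
Context {R : realFieldType} {X : Type}.
Variables (dist : X -> X -> R) (energy : X -> R) (D : set X) (lam : R).
Implicit Types (w x y z m v : X) (a c s C tau : R).

(* [C] plays the part of the squared pseudo-distance that a transport plan with
   base [w] induces between [x] and [y]. *)
Definition convex_with_base w : Prop :=
  forall x y, D x -> D y -> exists2 C, dist x y ^+ 2 <= C &
    forall a, 0 <= a <= 1 -> exists2 z, D z &
      energy z <= (1 - a) * energy x + a * energy y - a * (1 - a) * lam / 2 * C /\
      dist w z ^+ 2 + a * (1 - a) * C
        <= (1 - a) * dist w x ^+ 2 + a * dist w y ^+ 2.

Definition is_proximal tau w m : Prop :=
  D m /\ forall v, D v ->
    dist w m ^+ 2 + 2 * tau * energy m <= dist w v ^+ 2 + 2 * tau * energy v.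

(* There is no division by [dist x y], so that this also forces
   [energy x <= energy y] when [dist x y = 0]. *)
Definition slope_le x s : Prop :=
  forall c, s < c -> exists2 r, 0 < r & forall y, D y -> dist x y < r ->
    energy x - energy y <= c * dist x y.

Lemma sqr_dist_interpolation w x y a : convex_with_base w -> D x -> D y ->
  0 <= a <= 1 ->
  a * (1 - a) * dist x y ^+ 2 <= (1 - a) * dist w x ^+ 2 + a * dist w y ^+ 2.
Proof.
move=> cw Dx Dy a01; have [C dC /(_ a a01)[z _ [_]]] := cw x y Dx Dy.
apply: le_trans; rewrite -[leLHS]add0r lerD ?sqr_ge0// ler_wpM2l//.
by rewrite mulr_ge0//; lra.
Qed.

Lemma proximal_variational_inequality tau w m v :
  0 < tau -> 0 < 1 + lam * tau -> convex_with_base w -> is_proximal tau w m ->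
  D v ->
  (1 + lam * tau) * dist m v ^+ 2 <=
    dist w v ^+ 2 - dist w m ^+ 2 + 2 * tau * (energy v - energy m).
Proof.
move=> tau0 k0 cw [Dm m_min] Dv; have [C dC interp] := cw m v Dm Dv.
apply: (@le_trans _ _ ((1 + lam * tau) * C)); first by rewrite ler_pM2l.
apply: (ler_affine_limit (y := (1 + lam * tau) * C) ltr01) => a /andP[a0 a1].
have [|z Dz [ez wz]] := interp a; first by lra.
have t2 : 0 < 2 * tau by rewrite mulr_gt0.
rewrite -(ler_pM2l a0).
by have := m_min z Dz; have := ler_wpM2l (ltW t2) ez; lra.
Qed.

Section slope.
Hypotheses (dist_ge0 : forall x y, 0 <= dist x y)
  (distxx : forall x, dist x x = 0).

Lemma convex_with_base_geodesic x y a : convex_with_base x -> D x -> D y ->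
  0 <= a <= 1 -> exists2 z, D z &
    energy z <= (1 - a) * energy x + a * energy y
                - a * (1 - a) * lam / 2 * dist x y ^+ 2 /\
    dist x z <= a * dist x y.
Proof.
move=> cx Dx Dy a01; have [C dC interp] := cx x y Dx Dy.
rewrite distxx expr0n/= in interp.
have CE : C = dist x y ^+ 2.
  apply/eqP; rewrite eq_le dC andbT.
  apply: (ler_affine_limit (y := C) ltr01) => b /andP[b0 b1].
  have [|z _ [_ xz]] := interp b; first by lra.
  by rewrite -(ler_pM2l b0); have := sqr_ge0 (dist x z); lra.
have [z Dz [ez xz]] := interp a a01; exists z => //; rewrite -CE; split => //.
have a0 : 0 <= a * dist x y by rewrite mulr_ge0//; lra.
by rewrite -ler_sqr ?nnegrE//= exprMn; move: xz; rewrite CE; lra.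
Qed.

Lemma slope_le_global x y s : convex_with_base x -> D x -> D y ->
  0 <= s -> slope_le x s ->
  energy x - energy y <= s * dist x y - lam / 2 * dist x y ^+ 2.
Proof.
move=> cx Dx Dy s0 xs; set d := dist x y.
suff : energy x - energy y + lam / 2 * d ^+ 2 <= s * d by lra.
apply: (ler_affine_limit (y := d) ltr01) => e /andP[e0 _].
suff : energy x - energy y + lam / 2 * d ^+ 2 <= (s + e) * d by lra.
have [|r r0 x_descent] := xs (s + e); first by rewrite ltrDl.
have d1 : 0 < d + 1 by rewrite ltr_wpDl ?dist_ge0.
apply: (ler_affine_limit (y := lam / 2 * d ^+ 2)
  (b := Num.min 1 (r / (d + 1)))).
  by rewrite lt_min ltr01 divr_gt0.
move=> a; rewrite lt_min ltr_pdivlMr// => /andP[a0 /andP[a1 ar]].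
have [|z Dz [ez xz]] := convex_with_base_geodesic (a := a) cx Dx Dy.
  by lra.
rewrite -/d in ez xz.
have xz_descent : energy x - energy z <= (s + e) * dist x z.
  by apply: x_descent => //; apply: le_lt_trans xz _; lra.
have se0 : 0 <= s + e by rewrite addr_ge0// ltW.
by rewrite -(ler_pM2l a0); have := ler_wpM2l se0 xz; lra.
Qed.

End slope.

Section almost_contraction.
Hypothesis distC : forall x y, dist x y = dist y x.
Context {x y Jx Jy : X} {s tau : R}.
Hypotheses (tau_gt0 : 0 < tau) (lam_tau : 0 < 1 + lam * tau).
Hypotheses (convex_x : convex_with_base x) (convex_y : convex_with_base y).
Hypotheses (prox_x : is_proximal tau x Jx) (prox_y : is_proximal tau y Jy).
Hypotheses (Dx : D x) (slope_x : energy x - energy Jx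
  <= s * dist x Jx - lam / 2 * dist x Jx ^+ 2).

Local Notation k := (1 + lam * tau).

Let variational_x : k * dist Jx Jy ^+ 2 <=
  dist x Jy ^+ 2 - dist x Jx ^+ 2 + 2 * tau * (energy Jy - energy Jx).
Proof. exact: proximal_variational_inequality prox_y.1. Qed.

Let variational_y : k * dist x Jy ^+ 2 <=
  dist x y ^+ 2 - dist y Jy ^+ 2 + 2 * tau * (energy x - energy Jy).
Proof.
by rewrite (distC x y) (distC x Jy); exact: proximal_variational_inequality.
Qed.

Let slope_energy_drop : 2 * tau * (energy x - energy Jx)
  <= 2 * (tau * s) * dist x Jx - (k - 1) * dist x Jx ^+ 2.
Proof.
have t2 : 0 < 2 * tau by rewrite mulr_gt0.
by move: slope_x; rewrite -(ler_pM2l t2); lra.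
Qed.

Lemma almost_contraction_nonpos : lam <= 0 ->
  k ^+ 2 * dist Jx Jy ^+ 2 <= dist x y ^+ 2 + (tau * s) ^+ 2.
Proof.
move=> lam0; have k01 : 0 <= k <= 1.
  by rewrite ltW//= gerDl mulr_le0_ge0// ltW.
have := sqr_dist_interpolation convex_y Dx prox_y.1 k01; rewrite (distC y x).
have := ler_wpM2l (ltW lam_tau) variational_x.
have := ler_wpM2l (ltW lam_tau) variational_y.
have := ler_wpM2l (ltW lam_tau) slope_energy_drop.
by have := sqr_ge0 (tau * s - k * dist x Jx); lra.
Qed.

Lemma almost_contraction_nonneg : 0 <= lam ->
  k ^+ 2 * dist Jx Jy ^+ 2 <= dist x y ^+ 2 + (tau * s) ^+ 2
    + 2 * lam * tau ^+ 2 * (energy Jy - energy Jx).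
Proof.
move=> lam0.
have kd : 0 <= (k - 1) * dist x Jx ^+ 2.
  by rewrite addrC addKr mulr_ge0 ?sqr_ge0 ?mulr_ge0// ltW.
have := ler_wpM2l (ltW lam_tau) variational_x.
have := sqr_ge0 (dist y Jy); have := sqr_ge0 (tau * s - dist x Jx).
by move: variational_y slope_energy_drop kd; lra.
Qed.

End almost_contraction.
End generalized_convexity.

Section real_Wasserstein_distance.
Context {R : realType} {d : nat}.
Implicit Types mu nu : probability (Rd R d) R.

Definition rW2 mu nu : R := fine (W2 mu nu).

Lemma rW2_ge0 mu nu : 0 <= rW2 mu nu.
Proof. exact/fine_ge0/sqrte_ge0. Qed.

Lemma rW2C mu nu : rW2 mu nu = rW2 nu mu.
Proof. by rewrite /rW2 /W2 W2sqC. Qed.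

Lemma rW2xx mu : rW2 mu mu = 0.
Proof. by rewrite /rW2 /W2 W2sqxx sqrte0. Qed.

Context {omega0 : probability (Rd R d) R}.
Local Notation P2 := (P2 omega0).

Lemma P2P mu : P2 mu <-> (W2sq mu omega0 < +oo)%E.
Proof.
rewrite /Defs.P2 /= -!ge0_fin_numE ?sqrte_ge0 ?W2sq_ge0//.
by rewrite sqrte_fin_num ?W2sq_ge0.
Qed.

Lemma P2_W2sq_lty mu nu : P2 mu -> (W2sq mu nu < +oo)%E -> P2 nu.
Proof.
by move=> /P2P mu0 munu; apply/P2P; apply: W2sq_lty_trans mu0; rewrite W2sqC.
Qed.

Lemma W2sq_lty mu nu : P2 mu -> P2 nu -> (W2sq mu nu < +oo)%E.
Proof.
by move=> /P2P mu0 /P2P nu0; apply: W2sq_lty_trans mu0 _; rewrite W2sqC.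
Qed.

Lemma W2E mu nu : P2 mu -> P2 nu -> W2 mu nu = (rW2 mu nu)%:E.
Proof.
move=> hmu hnu; rewrite fineK// sqrte_fin_num ?W2sq_ge0//.
by rewrite ge0_fin_numE ?W2sq_ge0// W2sq_lty.
Qed.

Lemma W2sqE mu nu : P2 mu -> P2 nu -> W2sq mu nu = (rW2 mu nu ^+ 2)%:E.
Proof.
by move=> hmu hnu; rewrite EFin_expe -W2E// sqr_sqrte// W2sq_ge0.
Qed.

End real_Wasserstein_distance.

Lemma lt_inv_lambda_minus_gt0 {R : realType} (lam tau : R) : 0 < tau ->
  (tau%:E < inv_lambda_minus lam)%E -> 0 < 1 + lam * tau.
Proof.
move=> tau0; rewrite /inv_lambda_minus; case: ifPn => [lam0 _|].
  by rewrite ltr_wpDr// mulr_ge0// ltW.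
rewrite -ltNge => lam0; rewrite lte_fin -[ltRHS]div1r ltr_pdivlMr ?oppr_gt0//.
by rewrite mulrN ltrNl mulrC; lra.
Qed.

Section energy.
Context {R : realType} {d : nat} {omega0 : probability (Rd R d) R}.
Context {E : probability (Rd R d) R -> \bar R}.
Hypothesis E_ninfty : no_minus_infty omega0 E.
Implicit Types mu nu v w m : probability (Rd R d) R.
Local Notation P2 := (P2 omega0).
Local Notation domE := (domE omega0 E).
Local Notation rE := (fine \o E).

Lemma domE_fin_num mu : domE mu -> E mu \is a fin_num.
Proof. by move=> [hmu Emu]; rewrite fin_numE E_ninfty//= lt_eqF. Qed.

Lemma gg_convex_with_base lam w : gg_convex omega0 E lam -> P2 w ->
  convex_with_base rW2 rE domE lam w.
Proof.
move=> E_convex hw mu0 mu1 dmu0 dmu1; have [[hmu0 _] [hmu1 _]] := (dmu0, dmu1).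
have [W [[cW0 W0] [cW1 W1] WE]] := E_convex _ _ _ hmu0 hmu1 hw.
have [m1 m2 _ P2mu0] := cW0; have [_ m3 _ P3mu1] := cW1.
set K := cost W (fun x => x.1.2) (fun x => x.2) in WE.
have K_fin : K \is a fin_num.
  rewrite ge0_fin_numE ?cost_ge0//; apply: (cost_lty_trans m2 m1 m3).
    by rewrite costC W0; exact: W2sq_lty hw hmu0.
  by rewrite W1; exact: W2sq_lty hw hmu1.
exists (fine K).
  by rewrite -lee_fin -(W2sqE hmu0 hmu1) fineK//; exact: W2sq_le_cost.
move=> a a01.
have [mua muaE] := exists_law W (measurable_lincomb (1 - a) a m2 m3).
have := W2sq_interpolation cW0 cW1 a01 (fun A _ => muaE A).
rewrite -/K W0 W1 -(fineK K_fin) (W2sqE hw hmu0) (W2sqE hw hmu1).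
rewrite -!EFinM -EFinD => wmua.
have hmua : P2 mua.
  apply: (P2_W2sq_lty hw); rewrite ltNge leye_eq; apply/eqP => Woo.
  by rewrite Woo in wmua.
have := WE a a01 mua (fun A _ => muaE A).
rewrite -(fineK K_fin) -(fineK (domE_fin_num dmu0)) -(fineK (domE_fin_num dmu1)).
rewrite -!EFinM -EFinN -!EFinD => Emua.
have dmua : domE mua by split=> //; exact: le_lt_trans Emua (ltry _).
exists mua => //; rewrite (W2sqE hw hmua) -EFinD lee_fin in wmua.
by rewrite -lee_fin /= fineK ?domE_fin_num.
Qed.

Section JKO.
Context {tau : R} (tau_gt0 : 0 < tau).

Lemma JKO_proximal mu m : E_proper omega0 E -> P2 mu ->
  is_JKO omega0 E tau mu m -> is_proximal rW2 rE domE tau mu m.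
Proof.
move=> [v0 dv0] hmu [hm m_min].
have min_real v : domE v -> (((2 * tau)^-1 * rW2 mu m ^+ 2)%:E + E m <=
    ((2 * tau)^-1 * rW2 mu v ^+ 2 + fine (E v))%:E)%E.
  move=> dv; have [hv _] := dv.
  rewrite EFinD !(EFinM (2 * tau)^-1) -(W2sqE hmu hm) -(W2sqE hmu hv).
  by rewrite fineK ?domE_fin_num// m_min.
have dm : domE m.
  split=> //; rewrite ltNge leye_eq; apply/eqP => Em.
  by have := min_real _ dv0; rewrite Em addey.
split=> // v dv; have := min_real v dv.
rewrite -(fineK (domE_fin_num dm)) -EFinD lee_fin.
have t2 : 0 < 2 * tau by rewrite mulr_gt0.
by rewrite -(ler_pM2l t2) !mulrDr !mulrA divff ?mul1r// gt_eqF.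
Qed.

Lemma JKO_energy_le mu m : P2 mu -> is_JKO omega0 E tau mu m -> (E m <= E mu)%E.
Proof.
move=> hmu [hm /(_ mu hmu)]; rewrite W2sqxx mule0 add0e; apply: le_trans.
by rewrite leeDr// mule_ge0 ?W2sq_ge0// lee_fin invr_ge0 mulr_ge0// ltW.
Qed.

Lemma JKO_energy_drop mu nu Jmu Jnu : P2 nu ->
  is_JKO omega0 E tau mu Jmu -> is_JKO omega0 E tau nu Jnu ->
  (E Jnu - E Jmu <= E nu - infE omega0 E)%E.
Proof.
move=> hnu [hJmu _] JJnu; apply: leeB; first exact: JKO_energy_le JJnu.
by apply: ereal_inf_lbound; exists Jmu.
Qed.

End JKO.

Lemma W2_lsc_le_rW2_eq0 mu v : W2_lsc omega0 E -> domE mu -> domE v ->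
  rW2 mu v = 0 -> rE mu <= rE v.
Proof.
move=> E_lsc dmu dv w0; have [[hmu _] [hv _]] := (dmu, dv).
rewrite leNgt; apply/negP => Ev.
have [|delta [d0 E_gt]] := E_lsc mu hmu (rE v).
  by rewrite -(fineK (domE_fin_num dmu)) lte_fin.
have := E_gt v hv; rewrite (W2E hmu hv) w0 lte_fin => /(_ d0).
by rewrite /= fineK ?domE_fin_num// ltxx.
Qed.

Lemma metric_slope_ge0 mu : (0 <= metric_slope omega0 E mu)%E.
Proof.
apply: le_ereal_inf_tmp => _ [r _ <-].
by apply: ereal_sup_ubound; left.
Qed.

Lemma metric_slope_fin_num mu : dom_slope omega0 E mu ->
  metric_slope omega0 E mu \is a fin_num.
Proof. by move=> [_ mu_fin]; rewrite ge0_fin_numE// metric_slope_ge0. Qed.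

Lemma slope_le_metric_slope mu : W2_lsc omega0 E -> dom_slope omega0 E mu ->
  slope_le rW2 rE domE mu (fine (metric_slope omega0 E mu)).
Proof.
move=> E_lsc smu c; rewrite -lte_fin fineK ?metric_slope_fin_num//.
move=> /ereal_inf_lt[_ [r /= r0 <-]] sup_lt; have [dmu _] := smu.
exists r => // v dv mu_v; have [[hmu _] [hv _]] := (dmu, dv).
have [w0|w0] := eqVneq (rW2 mu v) 0.
  by rewrite w0 mulr0 subr_le0; exact: W2_lsc_le_rW2_eq0.
have {}w0 : 0 < rW2 mu v by rewrite lt_def w0 rW2_ge0.
rewrite -ler_pdivrMr// -lee_fin; apply: le_trans (ltW sup_lt).
apply: (@le_trans _ _ (maxe (E mu - E v) 0 * ((fine (W2 mu v))^-1)%:E)%E).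
  rewrite EFinM lee_pmul2r//; last by rewrite lte_fin invr_gt0.
  by rewrite le_max EFinB !fineK ?domE_fin_num ?lexx.
apply: ereal_sup_ubound; right; exists v => //.
by split=> //; rewrite (W2E hmu hv) !lte_fin w0.
Qed.

End energy.

Theorem theorem2p1 (R : realType) (d : nat) (omega0 : probability (Rd R d) R)
  (E : probability (Rd R d) R -> \bar R) (lam : R) :
  no_minus_infty omega0 E ->
  E_proper omega0 E -> E_coercive omega0 E -> W2_lsc omega0 E ->
  gg_convex omega0 E lam ->
  forall (mu nu : probability (Rd R d) R),
  dom_slope omega0 E mu -> closure_domE omega0 E nu ->
  forall tau : R, 0 < tau -> (tau%:E < inv_lambda_minus lam)%E ->
  forall Jmu Jnu : probability (Rd R d) R,
  is_JKO omega0 E tau mu Jmu -> is_JKO omega0 E tau nu Jnu ->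
  (0 < lam ->
    (((1 + lam * tau) ^+ 2)%:E * W2sq Jmu Jnu
      <= W2sq mu nu + (tau ^+ 2)%:E * (metric_slope omega0 E mu * metric_slope omega0 E mu)
         + (2 * lam * tau ^+ 2)%:E * (E nu - infE omega0 E))%E) /\
  (lam <= 0 ->
    (((1 + lam * tau) ^+ 2)%:E * W2sq Jmu Jnu
      <= W2sq mu nu + (tau ^+ 2)%:E * (metric_slope omega0 E mu * metric_slope omega0 E mu))%E).
Proof.
move=> E_ninfty E_prop _ E_lsc E_convex mu nu smu [hnu _] tau tau0 taulam.
move=> Jmu Jnu JJmu JJnu; have [dmu _] := smu; have [hmu _] := dmu.
have k0 := lt_inv_lambda_minus_gt0 tau0 taulam.
have convex_mu := gg_convex_with_base E_ninfty E_convex hmu.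
have convex_nu := gg_convex_with_base E_ninfty E_convex hnu.
have prox_mu := JKO_proximal E_ninfty tau0 E_prop hmu JJmu.
have prox_nu := JKO_proximal E_ninfty tau0 E_prop hnu JJnu.
have [[dJmu _] [dJnu _]] := (prox_mu, prox_nu).
have slope_mu := slope_le_global rW2_ge0 rW2xx convex_mu dmu dJmu
  (fine_ge0 (metric_slope_ge0 mu)) (slope_le_metric_slope E_ninfty E_lsc smu).
rewrite (W2sqE hmu hnu) (W2sqE dJmu.1 dJnu.1) -(fineK (metric_slope_fin_num smu)).
rewrite -!EFinM -expr2 -(exprMn _ tau) -EFinD; split=> lam0.
- have c0 : (0 <= (2 * lam * tau ^+ 2)%:E)%E by rewrite lee_fin !mulr_ge0// ltW.
  have E_drop := JKO_energy_drop tau0 hnu JJmu JJnu.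
  apply: le_trans (leeD2l _ (lee_wpmul2l c0 E_drop)).
  rewrite -(fineK (domE_fin_num E_ninfty dJmu)).
  rewrite -(fineK (domE_fin_num E_ninfty dJnu)) -EFinB -EFinM -EFinD lee_fin.
  exact: (almost_contraction_nonneg rW2C tau0 k0 convex_mu convex_nu
    prox_mu prox_nu dmu slope_mu (ltW lam0)).
- rewrite lee_fin; exact: (almost_contraction_nonpos rW2C tau0 k0 convex_mu
    convex_nu prox_mu prox_nu dmu slope_mu).
Qed.
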